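(* Let $K$ be a field of characteristic zero, let $n\ge 6$ be even, and let $Q_n$ be the $n$-dimensional filiform Lie algebra over $K$ with basis $(e_1,\dots,e_n)$ and Lie brackets $[e_1,e_i]=e_{i+1}$ for $2\le i\le n-1$ and $[e_i,e_{n-i+1}]=(-1)^{i+1}e_n$ for $2\le i\le \frac n2$ (all other brackets of basis vectors being zero except those forced by antisymmetry). Then $\mathrm{AID}(Q_n)=\mathrm{Inn}(Q_n)$.
   Context: For a finite-dimensional Lie algebra $\mathfrak{g}$ over a field $K$, let $\mathrm{Inn}(\mathfrak{g})=\{\mathrm{ad}(x)\mid x\in\mathfrak{g}\}$ be the inner derivations. A derivation $D$ of $\mathfrak{g}$ is called almost inner if $D(x)\in[\mathfrak{g},x]=\{[y,x]\mid y\in\mathfrak{g}\}$ for all $x\in\mathfrak{g}$. The space of almost inner derivations is denoted $\mathrm{AID}(\mathfrak{g})$. *)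

(* Defs.v *)
From HB Require Import structures.
From mathcomp Require Import all_boot all_order all_algebra.
From mathcomp Require Import classical_sets.
From mathcomp Require Import zify ring.

Set Implicit Arguments.
Unset Strict Implicit.
Unset Printing Implicit Defensive.

Import GRing.Theory.
Local Open Scope ring_scope.

HB.mixin Record Vector_isLieAlgebra (K : fieldType) L of Vector K L := {
  lie : L -> L -> L;
  lie_linearl : forall y, linear (lie^~ y);
  lie_linearr : forall x, linear (lie x);
  liexx : forall x, lie x x = 0;
  lie_jacobi : forall x y z,
    lie x (lie y z) + lie y (lie z x) + lie z (lie x y) = 0
}.

#[short(type="lieAlgType")]
HB.structure Definition LieAlgebra (K : fieldType) :=
  { L of Vector_isLieAlgebra K L & Vector K L }.

HB.instance Definition _ (K : fieldType) (L : lieAlgType K) (x : L) :=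
  GRing.isLinear.Build K L L *:%R (lie x) (lie_linearr x).

Section Derivations.
Local Open Scope classical_set_scope.
Variables (K : fieldType) (L : lieAlgType K).
Implicit Type D : 'End(L).

Definition ad (x : L) : 'End(L) := linfun (lie x).

Lemma adE x y : ad x y = lie x y.
Proof. by rewrite lfunE. Qed.

Definition is_derivation D :=
  forall x y, D (lie x y) = lie (D x) y + lie x (D y).

Definition almost_inner D :=
  is_derivation D /\ forall x, [set lie y x | y in setT] (D x).

Definition Inn : set 'End(L) := range ad.

Definition AID : set 'End(L) := [set D | almost_inner D].

End Derivations.

Arguments Inn {K} L.
Arguments AID {K} L.

(* [be i] is the basis vector e_i, 1 <= i <= n, of the tuple e; tuples are
   indexed from 0. *)
Definition is_Qn (K : fieldType) (L : lieAlgType K) (n : nat)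
    (e : n.-tuple L) : Prop :=
  let be (i : nat) : L := e`_i.-1 in
  [/\ basis_of fullv e,
      forall i, (2 <= i <= n.-1)%N -> lie (be 1%N) (be i) = be i.+1,
      forall i, (2 <= i <= n./2)%N ->
        lie (be i) (be (n - i + 1)%N) = (-1) ^+ i.+1 *: be n
    & forall i j, (1 <= i < j)%N -> (j <= n)%N ->
        ~~ ((i == 1%N) && (2 <= j <= n.-1)%N) ->
        ~~ ((2 <= i <= n./2)%N && (j == n - i + 1)%N) ->
        lie (be i) (be j) = 0].

(* [is_Qn] is satisfiable for n = m.+1 even: on row vectors, take
   [u, v] = u_1 v S - v_1 u S + (u B v^T) e_n, where S is the shift
   e_i -> e_(i+1) for 1 < i, and B gives the brackets [e_i, e_(n-i+1)]. *)
Section Model.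
Variables (K : fieldType) (m : nat).
Hypotheses (K0 : [pchar K] =i pred0) (oddm : odd m).

Let V := 'rV[K]_m.+1.
Let S : 'M[K]_m.+1 := \matrix_(i, j) ((0 < i)%N && (j == i.+1 :> nat))%:R.
Let B : 'M[K]_m.+1 := \matrix_(i, j)
  (if [&& 0 < i, 0 < j & i + j == m]%N then (-1) ^+ i else 0).
Let last : V := delta_mx 0 ord_max.
Let form (u v : V) : K := (u *m B *m v^T) 0 0.
Let br (u v : V) : V :=
  u 0 0 *: (v *m S) - v 0 0 *: (u *m S) + form u v *: last.

Let formDl a u u' v : form (a *: u + u') v = a * form u v + form u' v.
Proof. by rewrite /form !mulmxDl -!scalemxAl !mxE. Qed.

Let formDr a u v v' : form u (a *: v + v') = a * form u v + form u v'.
Proof. by rewrite /form linearP /= mulmxDr -!scalemxAr !mxE. Qed.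

Let BT : B^T = - B.
Proof.
apply/matrixP => i j; rewrite !mxE andbCA addnC.
case: ifP => [/and3P[_ _ /eqP ijm]|_]; last by rewrite oppr0.
rewrite -signr_odd -[in RHS]signr_odd.
have : odd i != odd j by move: oddm; clear -ijm; lia.
by case: (odd i); case: (odd j) => //= _; rewrite ?opprK.
Qed.

Let formC u v : form u v = - form v u.
Proof.
have -> : form u v = (u *m B *m v^T)^T 0 0 by rewrite [RHS]mxE.
by rewrite !trmx_mul trmxK BT mulmxA mulmxN mulNmx mxE.
Qed.

Let formxx u : form u u = 0.
Proof.
have /eqP := formC u u; rewrite -subr_eq0 opprK -mulr2n -mulr_natl mulf_eq0.
case/orP => [h|/eqP //].
by have := K0 2%N; rewrite !inE /= h.
Qed.

Let mulS (u : V) (j : 'I_m.+1) :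
  (u *m S) 0 j = if (1 < j)%N then u 0 (inord j.-1) else 0.
Proof.
rewrite mxE; case: ifP => j1.
  have jm : (j.-1 < m.+1)%N by have := ltn_ord j; lia.
  rewrite (bigD1 (inord j.-1)) //= big1 ?addr0 => [|k /eqP nk]; rewrite !mxE.
    by rewrite inordK // (_ : _ && _) ?mulr1 //; lia.
  case: andP => [[k0 /eqP jk]|_]; rewrite ?mulr0 //.
  by case: nk; apply: val_inj; rewrite /= inordK //; lia.
rewrite big1 // => k _; rewrite !mxE.
by case: andP => [[k0 /eqP jk]|_]; rewrite ?mulr0 //; lia.
Qed.

Let SB : S *m B + B *m S^T = 0.
Proof.
have SBE (i j : 'I_m.+1) : (S *m B) i j =
    if [&& 0 < i, 0 < j & i + j == m.-1]%N then - (-1) ^+ i else 0.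
  rewrite mxE; case: ifP => [/and3P[i0 j0 /eqP ijm]|nij].
    have im : (i.+1 < m.+1)%N by lia.
    rewrite (bigD1 (Ordinal im)) //= big1 => [|k /eqP nk]; rewrite !mxE.
      rewrite i0 eqxx j0 /= addSn (_ : _ == _); last by apply/eqP; lia.
      by rewrite mul1r addr0 exprS mulN1r.
    case: andP => [[_ /eqP ki]|_]; rewrite ?mul0r //.
    by case: nk; apply: val_inj.
  rewrite big1 // => k _; rewrite !mxE.
  case: andP => [[i0 /eqP ki]|_]; rewrite ?mul0r // ifF ?mulr0 //.
  by apply/negP; move: nij; rewrite ki i0; lia.
have BTS : B *m S^T = - (S *m B)^T by rewrite trmx_mul BT mulNmx opprK.
apply/matrixP => i j; rewrite BTS [LHS]mxE [X in _ + X]mxE [X in _ - X]mxE.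
rewrite !SBE [RHS]mxE [(j + i)%N]addnC [in X in _ - X]andbCA.
case: ifP => [/and3P[_ _ /eqP ijm]|_]; last by rewrite subr0.
rewrite -signr_odd -[in X in _ - X]signr_odd.
have -> : odd i = odd j by move: oddm; clear -ijm; lia.
by rewrite opprK addNr.
Qed.

Let formS u v : form (u *m S) v + form u (v *m S) = 0.
Proof.
have -> : form (u *m S) v + form u (v *m S) =
    (u *m (S *m B + B *m S^T) *m v^T) 0 0.
  by rewrite mulmxDr mulmxDl [RHS]mxE /form trmx_mul !mulmxA.
by rewrite SB mulmx0 mul0mx mxE.
Qed.

Let last0 : last 0 0 = 0.
Proof.
by rewrite mxE eqxx /=; case: eqP => // /(congr1 val) /= m0; move: oddm; rewrite -m0.
Qed.

Let lastS : last *m S = 0.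
Proof.
apply/rowP => j; rewrite mulS !mxE eqxx /=; case: ifP => // j1.
by case: eqP => // /(congr1 val) /=; have jm := ltn_ord j; rewrite inordK; lia.
Qed.

Let forml u : form last u = 0.
Proof.
have -> : form last u = (row ord_max B *m u^T) 0 0 by rewrite /form -rowE.
rewrite mxE big1 // => k _; rewrite !mxE ifF ?mul0r //.
by apply/negP => /and3P[_ k0 /eqP /=]; lia.
Qed.

Let mulS0 (u : V) : (u *m S) 0 0 = 0. Proof. by rewrite mulS. Qed.

Let formDl2 a b u u' v :
  form (a *: u - b *: u') v = a * form u v - b * form u' v.
Proof. by rewrite /form !mulmxBl -!scalemxAl !mxE. Qed.

Let br0 u v : br u v 0 0 = 0.
Proof.
have E (A C D : V) : (A - C + D) 0 0 = A 0 0 - C 0 0 + D 0 0.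
  by rewrite [LHS]mxE [X in X + _]mxE [X in _ + X + _]mxE.
have Z a (A : V) : (a *: A) 0 0 = a * A 0 0 by rewrite [LHS]mxE.
by rewrite /br E !Z !mulS0 last0 !mulr0 subr0 addr0.
Qed.

Let brS u v : br u v *m S = u 0 0 *: (v *m S *m S) - v 0 0 *: (u *m S *m S).
Proof. by rewrite !mulmxDl mulNmx -!scalemxAl lastS scaler0 addr0. Qed.

Let form_brr x u v :
  form x (br u v) = u 0 0 * form x (v *m S) - v 0 0 * form x (u *m S).
Proof.
by rewrite [LHS]formC /br addrC formDl forml mulr0 add0r formDl2 !(formC x) !mulrN
  opprB opprK addrC.
Qed.

Let formSC x z : form x (z *m S) = form z (x *m S).
Proof.
have /eqP := formS z x; rewrite addr_eq0 => /eqP zx.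
by rewrite formC zx opprK.
Qed.

Let br_linearl v : linear (br^~ v).
Proof.
move=> a u u' /=; apply/rowP => j; rewrite /br formDl mulmxDl -scalemxAl !mxE.
by ring.
Qed.

Let br_linearr u : linear (br u).
Proof.
move=> a v v' /=; apply/rowP => j; rewrite /br formDr mulmxDl -scalemxAl !mxE.
by ring.
Qed.

Let brxx u : br u u = 0.
Proof. by rewrite /br formxx scale0r addr0 subrr. Qed.

Let br_jacobi x y z : br x (br y z) + br y (br z x) + br z (br x y) = 0.
Proof.
rewrite {1 3 5}/br !brS !br0 !form_brr.
rewrite (formSC z x) (formSC z y) (formSC y x).
apply/rowP => j; move: (x *m S *m S) (y *m S *m S) (z *m S *m S) => X Y Z.
move: (form _ _) (form _ _) (form _ _) => f g h; rewrite !mxE.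
by ring.
Qed.

Lemma Qn_exists : exists (L : lieAlgType K) (e : m.+1.-tuple L), is_Qn e.
Proof.
pose mix := Vector_isLieAlgebra.Build K V br_linearl br_linearr brxx br_jacobi.
pose L : lieAlgType K := HB.pack 'rV[K]_m.+1 mix.
pose d i : V := delta_mx 0 i.
have formd i j : form (d i) (d j) = B i j.
  by rewrite /form /d -rowE trmx_delta -colE !mxE.
have brd i j : br (d i) (d j) = (i == 0)%:R *: row j S - (j == 0)%:R *: row i S
                                + B i j *: last.
  by rewrite /br formd -!rowE !mxE !eqxx /= ![0 == _]eq_sym.
pose e : m.+1.-tuple L := [tuple (d i : L) | i < m.+1].
have nthe i (im : (i < m.+1)%N) : (e : seq L)`_i = d (Ordinal im) :> V.
  rewrite /e /= (nth_map ord0) ?size_enum_ord //.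
  by congr d; apply: val_inj; rewrite /= nth_enum_ord.
have lieE i j (im : (i < m.+1)%N) (jm : (j < m.+1)%N) :
    lie (e : seq L)`_i (e : seq L)`_j = br (d (Ordinal im)) (d (Ordinal jm)).
  by rewrite !nthe.
exists L, e; split.
- rewrite basisEfree subvf size_tuple; apply/and3P; split => //; last first.
    by rewrite dimvf /dim /= mul1n.
  apply/freeP => k; rewrite (eq_bigr (fun i => k i *: (d i : L))); last first.
    by move=> i _; rewrite nthe; congr (_ *: d _); apply: val_inj.
  move=> k0 j; have /rowP/(_ j) : \sum_i k i *: d i = 0 :> V by exact: k0.
  rewrite summxE (bigD1 j) //= big1 ?addr0 => [|i ij]; rewrite !mxE ?eqxx ?mulr1 //.
  by rewrite [j == i]eq_sym (negbTE ij) mulr0.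
- move=> i /andP[i2 im].
  have i1m : (i.-1 < m.+1)%N by lia.
  have im1 : (i.+1.-1 < m.+1)%N by lia.
  rewrite lieE brd nthe; apply/rowP => j; rewrite !mxE eqxx /=.
  rewrite mul0r mulr0 subr0 addr0 mul1r -[j == Ordinal _]val_eqE /= prednK; last by lia.
  by rewrite (_ : (0 < i.-1)%N) //; lia.
- move=> i /andP[i2 im].
  have i1m : (i.-1 < m.+1)%N by lia.
  have j1m : ((m.+1 - i + 1).-1 < m.+1)%N by lia.
  have mm : (m < m.+1)%N by [].
  rewrite lieE brd [RHS](_ : _ = (-1) ^+ i.+1 *: d (Ordinal mm) :> V); last first.
    by rewrite -nthe.
  have -> : (Ordinal i1m == 0) = false by apply/eqP => /(congr1 val) /=; lia.
  have -> : (Ordinal j1m == 0) = false by apply/eqP => /(congr1 val) /=; lia.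
  rewrite !scale0r subrr add0r mxE /= ifT; last by lia.
  congr (_ *: d _); last by apply: val_inj.
  by case: i i2 {im i1m j1m} => // i _; rewrite /= !exprS !mulN1r opprK.
- move=> i j /andP[i0 ij] jm nij1 nij2.
  have i1m : (i.-1 < m.+1)%N by lia.
  have j1m : (j.-1 < m.+1)%N by lia.
  rewrite lieE brd.
  have -> : (Ordinal j1m == 0) = false by apply/eqP => /(congr1 val) /=; lia.
  rewrite scale0r subr0 mxE /= ifF ?scale0r ?addr0; last first.
    by apply/negP => /and3P[i1 j1 /eqP ijm]; move/negP: nij2; apply; lia.
  case: eqP => [/(congr1 val) /= i1|_]; last by rewrite scale0r.
  apply/rowP => k; rewrite scale1r !mxE /=.
  by have := ltn_ord k; case: andP => // -[j1 /eqP kj]; lia.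
Qed.

End Model.

(* Main.v *)
Require Import Defs.
From mathcomp Require Import all_boot all_order all_algebra.
From mathcomp Require Import classical_sets.
From mathcomp Require Import zify.

Import GRing.Theory.
Local Open Scope ring_scope.

(** Inner derivations are almost inner by the Jacobi identity.  Conversely,
    [AID] is stable under adding inner derivations, so an almost inner [D] may
    be corrected by inner ones until it vanishes.

    As [D e_1 = [y, e_1]] for some [y], subtracting [ad y] achieves
    [D e_1 = 0].  As [[Q_n, e_2]] is spanned by [e_3 = [e_1, e_2]] and [e_n],
    subtracting a multiple of [ad e_1] then leaves [D e_2 = b e_n].  The
    algebra is generated by [e_1] and [e_2], and [e_n] commutes with [e_1], so
    such a [D] kills all basis vectors but [e_2]: only the scalar [b] is left.

    It is killed by testing almost innerness at [e_1 + e_2].  This vector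
    is chosen because [e_1] and [e_2] both send [e_(n-1)] to a multiple
    of [e_n], with opposite signs, and neither sends any other basis vector to
    a nonzero multiple of [e_n].  Hence [[Q_n, e_1 + e_2]] has no component
    along [e_n], while it contains [D (e_1 + e_2) = b e_n]. *)

Section AlmostInner.
Set Implicit Arguments.
Unset Strict Implicit.
Variables (K : fieldType) (L : lieAlgType K).
Implicit Types (x y z : L) (D : 'End(L)).

Lemma lieDl x y z : lie (x + y) z = lie x z + lie y z.
Proof. by have := lie_linearl z 1 x y; rewrite /= !scale1r. Qed.

Lemma lieZl a x y : lie (a *: x) y = a *: lie x y.
Proof.
have lie0 : lie 0 y = 0 by apply: (addrI (lie 0 y)); rewrite -lieDl !addr0.
by have := lie_linearl y a x 0; rewrite /= lie0 !addr0.
Qed.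

Lemma lieC x y : lie x y = - lie y x.
Proof.
apply/eqP; rewrite -addr_eq0; apply/eqP.
by have := liexx (x + y); rewrite lieDl !linearD /= !liexx add0r addr0.
Qed.

Lemma lieNl x y : lie (- x) y = - lie x y.
Proof. by rewrite -scaleN1r lieZl scaleN1r. Qed.

Lemma ad_almost_inner x : almost_inner (ad x).
Proof.
split=> [y z|y]; last by exists x; rewrite // adE.
rewrite !adE; have /eqP := lie_jacobi x y z.
rewrite [lie z x]lieC [lie z _]lieC linearN /= -addrA -opprD subr_eq0.
by move/eqP->; rewrite addrC.
Qed.

Lemma almost_innerBad D y : almost_inner D -> almost_inner (D - ad y).
Proof.
move=> [derD aiD]; have [dery _] := ad_almost_inner y; split=> [u v|u].
  rewrite !(add_lfunE, opp_lfunE) derD dery opprD addrACA linearB /=.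
  by rewrite lieDl lieNl.
have [z _ Du] := aiD u; exists (z - y) => //.
by rewrite !(add_lfunE, opp_lfunE) -Du adE lieDl lieNl.
Qed.

(** Bounds [[L, x]] from a bracket table; [U] is a span or the kernel of a
    coordinate form below. *)
Lemma memv_lie_basis n (e : n.-tuple L) x (U : {vspace L}) :
    basis_of fullv e -> (forall i, (i < n)%N -> lie e`_i x \in U) ->
  forall y, lie y x \in U.
Proof.
move=> eb eU y; rewrite (coord_basis eb (memvf y)) lieC memvN linear_sum /=.
by apply: memv_suml => i _; rewrite linearZ memvZ //= lieC memvN eU.
Qed.

End AlmostInner.

Section Qn.
Set Implicit Arguments.
Unset Strict Implicit.
Variables (K : fieldType) (n : nat) (Q : lieAlgType K) (e : n.-tuple Q).
Hypotheses (n_ge6 : (6 <= n)%N) (He : is_Qn e).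
Implicit Type D : 'End(Q).

(* Sequences are indexed from 0, so e_(i+1) is the entry i of [e]. *)
Local Notation e1 := e`_0.
Local Notation e2 := e`_1.
Local Notation e3 := e`_2.
Local Notation en1 := e`_n.-2.
Local Notation en := e`_n.-1.

Lemma Qn_basis : basis_of fullv e. Proof. by case: He. Qed.

Lemma Qn_lie_e1 i : (0 < i < n.-1)%N -> lie e1 e`_i = e`_i.+1.
Proof. by move=> ?; case: He => _ + _ _ => /(_ i.+1); apply; lia. Qed.

Lemma Qn_lie_e1_en : lie e1 en = 0.
Proof. by case: He => _ _ _ /(_ 1%N n); apply; lia. Qed.

Lemma Qn_lie_e2_en1 : lie e2 en1 = - en.
Proof.
case: He => _ _ /(_ 2%N) + _.
rewrite (_ : (n - 2 + 1).-1 = n.-2); last by lia.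
by rewrite !exprS expr0 mulr1 mulrN1 opprK mulN1r scaleN1r; apply; lia.
Qed.

Lemma Qn_lie_e2_eq0 i : (0 < i < n)%N -> i != n.-2 -> lie e2 e`_i = 0.
Proof.
case: (eqVneq i 1%N) => [-> _ _|i1 ? ?]; first exact: liexx.
by case: He => _ _ _ /(_ 2%N i.+1); apply; lia.
Qed.

Lemma Qn_lie_e2_mem y : lie y e2 \in (<[e3]> + <[en]>)%VS.
Proof.
apply: (memv_lie_basis Qn_basis) => i i_n.
have [->|i0] := posnP i.
  by rewrite Qn_lie_e1 ?(subvP (addvSl _ _)) ?memv_line //; lia.
rewrite lieC memvN; have [->|ni] := eqVneq i n.-2.
  by rewrite Qn_lie_e2_en1 memvN (subvP (addvSr _ _)) ?memv_line.
by rewrite Qn_lie_e2_eq0 ?mem0v //; lia.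
Qed.

(** The coordinate along [e_n] vanishes on [[Q_n, e_1 + e_2]]: it is enough to
    look at brackets with basis vectors, and at [e_(n-1)] the contributions of
    [e_1] and [e_2] cancel. *)
Lemma scale_en_eq_lie_e1De2 b y : b *: en = lie y (e1 + e2) -> b = 0.
Proof.
have en_lt : (n.-1 < n)%N by lia.
have free_e := basis_free Qn_basis.
pose c : 'Hom(Q, K^o) := linfun (coord e (Ordinal en_lt) : Q -> K^o).
have cE i : (i < n)%N -> c e`_i = (n.-1 == i)%:R.
  by move=> i_n; rewrite lfunE /= (coord_free (Ordinal i_n)) // eq_sym.
move=> /(congr1 c); rewrite linearZ /= cE // eqxx [b *: _]mulr1 => ->.
have ker_c i : (i < n.-1)%N -> e`_i \in lker c.
  move=> i_n; rewrite memv_ker cE; last by lia.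
  by rewrite gtn_eqF.
suff: lie y (e1 + e2) \in lker c by rewrite memv_ker => /eqP.
apply: (memv_lie_basis Qn_basis) => i i_n; rewrite linearD /=.
have [->|i0] := posnP i.
  by rewrite liexx add0r Qn_lie_e1 ?ker_c //; lia.
rewrite ![lie e`_i _]lieC; have [->|ni] := eqVneq i n.-2.
  rewrite Qn_lie_e1 ?Qn_lie_e2_en1; last by lia.
  by rewrite prednK ?opprK ?addNr ?mem0v //; lia.
rewrite Qn_lie_e2_eq0 ?i0 // oppr0 addr0 memvN.
have [->|ni1] := eqVneq i n.-1; first by rewrite Qn_lie_e1_en mem0v.
by rewrite Qn_lie_e1 ?ker_c //; lia.
Qed.

(** What remains after correction by inner derivations: almost innerness at
    [e_1 + e_2] forces [b = 0], and then [D] vanishes on the generators. *)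
Lemma Qn_almost_inner_eq0 D b :
  almost_inner D -> D e1 = 0 -> D e2 = b *: en -> D = 0.
Proof.
move=> [derD aiD] D1 D2.
have b0 : b = 0.
  have [y _ Dy] := aiD (e1 + e2); apply: (@scale_en_eq_lie_e1De2 _ y).
  by rewrite Dy linearD /= D1 D2 add0r.
have D0 i : (i < n)%N -> D e`_i = 0.
  elim: i => [//|[|i] IH] i_n; first by rewrite D2 b0 scale0r.
  rewrite -Qn_lie_e1; last by lia.
  by rewrite derD D1 IH ?linear0 ?addr0 1?lieC ?linear0 ?oppr0 //; lia.
apply/lfunP => v; rewrite zero_lfunE (coord_basis Qn_basis (memvf v)) linear_sum.
by apply: big1 => i _; rewrite linearZ /= D0 ?scaler0.
Qed.

End Qn.

Theorem proposition4p3 (K : fieldType) (K0 : [pchar K] =i pred0)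
    (n : nat) (n_ge6 : (6 <= n)%N) (n_even : ~~ odd n)
    (Q : lieAlgType K) (e : n.-tuple Q) (He : is_Qn e) :
  AID Q = Inn Q.
Proof.
apply/seteqP; split=> [D aiD|_ [x _ <-]]; last exact: ad_almost_inner.
have [y _ Dy] := aiD.2 e`_0.
have aiD' := almost_innerBad y aiD.
(* As [e_3 = [e_1, e_2]], its coefficient [a] below is that of [ad e_1]. *)
have [z _ Dz] := aiD'.2 e`_1.
have /memv_addP[_ /vlineP[a ->] [_ /vlineP[b ->] zab]] :=
  Qn_lie_e2_mem n_ge6 He z.
exists (y + a *: e`_0) => //.
have D0 : D - ad y - ad (a *: e`_0) = 0.
  apply: (Qn_almost_inner_eq0 n_ge6 He (b := b)).
  - exact: almost_innerBad.
  - by rewrite !(add_lfunE, opp_lfunE) -Dy !adE lieZl liexx scaler0 !subrr.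
  - rewrite add_lfunE -Dz zab opp_lfunE adE lieZl (Qn_lie_e1 n_ge6 He); last by lia.
    by rewrite addrAC subrr add0r.
apply/esym/eqP; rewrite -subr_eq0 -D0; apply/eqP/lfunP => v.
by rewrite !(add_lfunE, opp_lfunE) !adE lieDl opprD addrA.
Qed.
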